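(* Let $\{\mu_j\}$ be the filtering distributions and $\{\mu_j^N\}$ the bootstrap particle filter approximations with $N\ge 1$ particles (both defined in the context), for a fixed data sequence $\{y_j\}_{j\ge1}$. Assume that there exists $\kappa\in(0,1]$ such that for all $v\in\mathbb{R}^n$ and all $j\in\{0,1,2,\dots\}$ $$\kappa\le g_j(v)\le\kappa^{-1}.$$ Then, for every integer $J\ge 1$, $$d(\mu_J^N,\mu_J)\le\sum_{j=1}^J(2\kappa^{-2})^j\,\frac{1}{\sqrt N}.$$
   Context: Model: $v_{j+1}=\Psi(v_j)+\xi_j$, $v_0\sim N(m_0,C_0)$, $\xi_j\sim N(0,\Sigma)$ i.i.d., and $y_{j+1}=h(v_{j+1})+\eta_{j+1}$, $\eta_{j+1}\sim N(0,\Gamma)$ i.i.d., $j\in\{0,1,2,\dots\}$, with $v_0,\{\xi_j\},\{\eta_j\}$ mutually independent, $\Psi\in C(\mathbb{R}^n,\mathbb{R}^n)$, $h\in C(\mathbb{R}^n,\mathbb{R}^m)$, and $C_0,\Sigma,\Gamma$ symmetric positive-definite. Let $p(v',dv)$ be the Markov kernel of the chain, i.e. $p(v',\cdot)=N(\Psi(v'),\Sigma)$. For the fixed data, let $g_j(v)$ be a function proportional to $\exp\bigl(-\tfrac12|\Gamma^{-1/2}(y_{j+1}-h(v))|^2\bigr)$, i.e. to the likelihood $\mathbb{P}(y_{j+1}|v_{j+1}=v)$, with constant of proportionality independent of $v$ and $y_{j+1}$. On the space $\mathcal{P}(\mathbb{R}^n)$ of Borel probability measures define $$(L_j\mu)(dv)=\frac{g_j(v)\mu(dv)}{\int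 g_j(v)\mu(dv)},\qquad (P\mu)(dv)=\int_{\mathbb{R}^n}p(v',dv)\,\mu(dv'),\qquad (S^N\mu)(dv)=\frac1N\sum_{n=1}^N\delta_{v^{(n)}}(dv),\quad v^{(n)}\sim\mu\ \text{i.i.d.}$$ $L_j$ and $P$ are deterministic maps; $S^N$ is random, and each application of $S^N$ uses fresh samples that are, conditionally on the (possibly random) measure being sampled, i.i.d. and independent of all earlier randomness. Filtering distributions ($\mu_j$ is the law of $v_j|y_1,\dots,y_j$): $\mu_{j+1}=L_jP\mu_j$, $\mu_0=N(m_0,C_0)$. Particle filter: $\mu_{j+1}^N=L_jS^NP\mu_j^N$, $\mu_0^N=\mu_0$. For random probability measures $\mu=\mu_\omega,\nu=\nu_\omega$ on $\mathbb{R}^n$ ($\omega$ being the randomness in the sampling), $$d(\mu,\nu)=\sup_{|f|_\infty\le1}\sqrt{\mathbb{E}^\omega|\mu(f)-\nu(f)|^2},$$ the supremum over measurable $f:\mathbb{R}^n\to\mathbb{R}$ with $|f|_\infty=\sup_u|f(u)|\le1$, where $\mu(f)=\int f\,d\mu$. *)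

(* Defs.v *)
From HB Require Import structures.
From mathcomp Require Import all_boot all_order all_algebra.
From mathcomp Require Import all_classical all_reals all_analysis measurable_realfun.

Set Implicit Arguments.
Unset Strict Implicit.
Unset Printing Implicit Defensive.

Import Order.TTheory GRing.Theory Num.Theory.
Import numFieldNormedType.Exports.

Local Open Scope classical_set_scope.
Local Open Scope ring_scope.

(* Matrices carry the Borel sigma-algebra of their (product) topology; R^n is
   represented by the column vectors 'cV[R]_n. *)
HB.instance Definition _ (R : realType) (m n : nat) :=
  Measurable.copy 'M[R]_(m, n) (g_sigma_algebraType (@open 'M[R]_(m, n))).

Section borel_mx.
Context (R : realType).

Lemma open_measurable_mx m n (U : set 'M[R]_(m, n)) : open U -> measurable U.
Proof. by move=> oU; exact: sub_sigma_algebra. Qed.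

Lemma measurable_ball_coord d (T : measurableType d) m n
    (f : T -> 'M[R]_(m, n)) (x : 'M[R]_(m, n)) (e : R) :
  (forall i j, measurable_fun setT (fun t => f t i j)) ->
  measurable (f @^-1` ball x e).
Proof.
move=> mf.
have [e0|e0] := ltP 0 e; last first.
  rewrite (_ : _ @^-1` _ = set0); first exact: measurable0.
  apply/seteqP; split => t //= -[] /=; by rewrite ltNge e0.
rewrite (_ : _ @^-1` _ =
   \bigcap_(ij in [set: 'I_m * 'I_n])
     ((fun t => f t ij.1 ij.2) @^-1` ball (x ij.1 ij.2) e)).
  apply: fin_bigcap_measurable; first exact: finite_finset.
  move=> [i j] _ /=; rewrite -[X in measurable X]setTI; apply: mf => //.
  by apply: measurable_ball.
apply/seteqP; split => t /=; first by move=> [_ H] ij _; exact: H.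
by move=> H; split => // i j; exact: (H (i, j)).
Qed.

Lemma measurable_mx_coord d (T : measurableType d) m n (f : T -> 'M[R]_(m, n)) :
  (forall i j, measurable_fun setT (fun t => f t i j)) ->
  measurable_fun setT f.
Proof.
move=> mf.
apply: (@measurability _ _ _ _ setT f (@open 'M[R]_(m, n))) => //.
move=> _ [U oU <-]; rewrite setTI.
pose q (p : 'M[rat]_(m, n)) : 'M[R]_(m, n) := map_mx ratr p.
pose D := [set pk : 'M[rat]_(m, n) * nat | ball (q pk.1) (pk.2.+1%:R^-1) `<=` U].
rewrite (_ : U = \bigcup_(pk in D) ball (q pk.1) (pk.2.+1%:R^-1 : R)).
  rewrite preimage_bigcup bigcup_mkcond.
  apply: countable_bigcupT_measurable => [|pk]; first exact: countableP.
  by case: ifP => // _; exact: measurable_ball_coord.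
apply/seteqP; split => [x Ux|x [pk + xpk]]; last by apply.
have /nbhs_ballP[e /= e0 xeU] : nbhs x U by exact: open_nbhs_nbhs.
have [k ke] : exists k : nat, k.+1%:R^-1 < e / 2 :> R.
  exists (Num.truncn (e / 2)^-1); rewrite invf_plt ?posrE ?divr_gt0//.
  by rewrite truncnS_gt.
have k0 : (0 : R) < k.+1%:R^-1 by rewrite invr_gt0.
have Hr (i : 'I_m) (j : 'I_n) : exists r : rat, `|x i j - ratr r| < k.+1%:R^-1.
  have [r] := @rat_in_itvoo R (x i j - k.+1%:R^-1) (x i j + k.+1%:R^-1)
    ltac:(by rewrite ltrD2l (lt_trans _ k0)// oppr_lt0).
  rewrite in_itv/= => /andP[r1 r2]; exists r.
  by rewrite distrC ltr_distl r1.
have [r rP] := choice (fun ij : 'I_m * 'I_n => Hr ij.1 ij.2).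
pose p := \matrix_(i, j) r (i, j).
exists (p, k); last first.
  split => //= i j; rewrite !mxE /ball /= distrC.
  exact: (rP (i, j)).
move=> z [_ /= pz]; apply: xeU; split => // i j.
have /= := rP (i, j); have := pz i j; rewrite !mxE /ball /= => h1 h2.
rewrite (le_lt_trans (ler_distD (ratr (r (i, j))) _ _))//.
rewrite (splitr e) ltrD//; exact: lt_trans ke.
Qed.

Lemma continuous_measurable_mx m n p q (f : 'M[R]_(m, n) -> 'M[R]_(p, q)) :
  continuous f -> measurable_fun setT f.
Proof.
move=> /continuousP cf; apply: (measurability (@open 'M[R]_(p, q))) => //.
by move=> _ [U oU <-]; rewrite setTI; apply: open_measurable_mx; exact: cf.
Qed.

Lemma measurable_coord m n i j :
  measurable_fun setT (fun A : 'M[R]_(m, n) => A i j).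
Proof.
have /continuousP cf := @coord_continuous R m n i j.
apply: (measurability _ (RGenOpens.measurableE R)) => //.
move=> _ [_ [a [b ->] <-]]; rewrite setTI; apply: open_measurable_mx.
exact/cf/interval_open.
Qed.

End borel_mx.

Section gaussian.
Context (R : realType).

Definition posdef n (A : 'M[R]_n) :=
  A^T = A /\ forall x : 'cV[R]_n, x != 0 -> 0 < (x^T *m A *m x) 0 0.

(* A^{1/2}: the unique symmetric positive-definite square root *)
Definition sqrtmx n (A : 'M[R]_n) : 'M[R]_n :=
  xget 0 [set B | posdef B /\ B *m B = A].

(* Euclidean norm; the library norm `|x| on matrices is the sup norm *)
Definition enorm n (x : 'cV[R]_n) : R := Num.sqrt (\sum_(i < n) x i 0 ^+ 2).

Definition cons_cV n (p : measurableTypeR R * 'cV[R]_n) : 'cV[R]_n.+1 :=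
  col_mx (p.1%:M : 'M[R]_1) p.2.

Lemma measurable_cons_cV n : measurable_fun setT (@cons_cV n).
Proof.
apply: measurable_mx_coord => i j; rewrite ord1.
rewrite /cons_cV; under eq_fun do rewrite mxE.
case: (fintype.split (i : 'I_(1 + n))) => k.
  under eq_fun do rewrite mxE ord1 eqxx mulr1n.
  exact: measurable_fst.
exact: (measurableT_comp (measurable_coord k 0) measurable_snd).
Qed.

HB.instance Definition _ n :=
  isMeasurableFun.Build _ _ _ _ (@cons_cV n) (@measurable_cons_cV n).

(* N(0, I_n): the law of n independent standard normal coordinates *)
Fixpoint std_gaussian n : probability 'cV[R]_n R :=
  if n is k.+1 then
    distribution (normal_prob (0 : R) 1 \x std_gaussian k)%E
      (@cons_cV k)
  else \d_(0 : 'cV[R]_0).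

Lemma measurable_mulmx m n (A : 'M[R]_(m, n)) :
  measurable_fun setT (fun z : 'cV[R]_n => A *m z).
Proof.
apply: measurable_mx_coord => i j.
under eq_fun do rewrite mxE.
apply: measurable_sum => k; apply: measurable_funM => //.
exact: measurable_coord.
Qed.

Lemma measurable_addmx n d (T : measurableType d) (f g : T -> 'cV[R]_n) :
  measurable_fun setT f -> measurable_fun setT g ->
  measurable_fun setT (fun t => f t + g t).
Proof.
move=> mf mg; apply: measurable_mx_coord => i j.
under eq_fun do rewrite mxE.
by apply: measurable_funD; apply: (measurableT_comp (measurable_coord i j)).
Qed.

Definition affine n (m : 'cV[R]_n) (A : 'M[R]_n) (z : 'cV[R]_n) := m + A *m z.

Lemma measurable_affine n (m : 'cV[R]_n) A : measurable_fun setT (affine m A).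
Proof. by apply: measurable_addmx => //; exact: measurable_mulmx. Qed.

HB.instance Definition _ n (m : 'cV[R]_n) A :=
  isMeasurableFun.Build _ _ _ _ (affine m A) (measurable_affine m A).

(* N(m, C), as the law of m + C^{1/2} Z with Z ~ N(0, I_n) *)
Definition gaussian n (m : 'cV[R]_n) (C : 'M[R]_n) : probability 'cV[R]_n R :=
  distribution (std_gaussian n) (affine m (sqrtmx C)).

End gaussian.

Section transition_kernel.
Context (R : realType) (n : nat).
Variables (Psi : continuousType 'cV[R]_n 'cV[R]_n) (Sigma : 'M[R]_n).

Definition transition (v : 'cV[R]_n) : {measure set 'cV[R]_n -> \bar R} :=
  gaussian (Psi v) Sigma.

Let measurable_transition B :
  measurable B -> measurable_fun setT (transition ^~ B).
Proof.
move=> mB.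
pose f (p : 'cV[R]_n * 'cV[R]_n) := Psi p.1 + sqrtmx Sigma *m p.2.
have mf : measurable_fun setT f.
  apply: measurable_addmx.
    apply: (measurableT_comp _ measurable_fst).
    by apply: continuous_measurable_mx => x; exact: cts_fun.
  exact: (measurableT_comp (measurable_mulmx _) measurable_snd).
have mA : measurable (f @^-1` B) by rewrite -[X in measurable X]setTI; exact: mf.
have := measurable_fun_xsection (std_gaussian R n) mA.
rewrite (_ : _ \o _ = transition ^~ B)//.
by apply/funext => v /=; rewrite xsectionE.
Qed.

HB.instance Definition _ :=
  isKernel.Build _ _ _ _ _ transition measurable_transition.

Let transition_setT v : transition v setT = 1%E.
Proof. exact: probability_setT. Qed.

HB.instance Definition _ :=
  Kernel_isProbability.Build _ _ _ _ _ transition transition_setT.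

End transition_kernel.

(* (P mu)(B) = \int p(v, B) mu(dv) *)
Section predict.
Local Open Scope ereal_scope.
Context d (T : measurableType d) (R : realType).
Variables (p : R.-pker T ~> T) (mu : probability T R).

Definition predict (B : set T) : \bar R := \int[mu]_v p v B.

Let predict0 : predict set0 = 0.
Proof. by apply: integral0_eq => v _; rewrite measure0. Qed.

Let predict_ge0 B : 0 <= predict B.
Proof. exact: integral_ge0. Qed.

Let predict_sigma_additive : semi_sigma_additive predict.
Proof.
move=> U mU tU mUU; rewrite [X in _ --> X](_ : _ =
  \int[mu]_v (\sum_(n <oo) p v (U n))); last first.
  apply: eq_integral => v _.
  by apply/esym/cvg_lim => //; exact/measure_semi_sigma_additive.
apply/cvg_closeP; split.
  by apply: is_cvg_nneseries => n _ _; exact: integral_ge0.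
by rewrite closeE// integral_nneseries// => n; exact: measurable_kernel.
Qed.

HB.instance Definition _ := isMeasure.Build _ _ _ predict
  predict0 predict_ge0 predict_sigma_additive.

Let predict_setT : predict setT = 1.
Proof.
rewrite /predict; under eq_integral do rewrite prob_kernel.
by rewrite integral_cst// mul1e; exact: probability_setT.
Qed.

HB.instance Definition _ :=
  Measure_isProbability.Build _ _ _ predict predict_setT.

End predict.

Section likelihood.
Context (R : realType) (n m : nat).
Variables (h : continuousType 'cV[R]_n 'cV[R]_m) (Gamma : 'M[R]_m).
Variables (c : {posnum R}) (y : 'cV[R]_m).

(* c exp(-|Gamma^{-1/2} (y - h(v))|^2 / 2) *)
Definition likelihood (v : 'cV[R]_n) : R :=
  c%:num * expR (- (2^-1 * enorm (invmx (sqrtmx Gamma) *m (y - h v)) ^+ 2)).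

Lemma likelihood_gt0 v : 0 < likelihood v.
Proof. by rewrite mulr_gt0// expR_gt0. Qed.

Lemma measurable_likelihood : measurable_fun setT likelihood.
Proof.
apply: measurable_funM => //; apply: measurableT_comp => //.
apply: measurableT_comp => //; apply: measurable_funM => //.
apply: measurable_funX; rewrite /enorm.
apply: (measurableT_comp (continuous_measurable_fun (@sqrt_continuous R))).
apply: measurable_sum => i; apply: measurable_funX.
apply: (measurableT_comp (measurable_coord i 0)).
apply: (measurableT_comp (measurable_mulmx _)).
have mh : measurable_fun setT h.
  by apply: continuous_measurable_mx => x; exact: cts_fun.
apply: measurable_addmx => //; apply: measurable_mx_coord => k l.
under eq_fun do rewrite mxE.
apply: measurableT_comp => //; exact: (measurableT_comp (measurable_coord k l)).
Qed.

End likelihood.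

(* (L mu)(B) = \int_B g dmu / \int g dmu *)
Section analysis.
Local Open Scope ereal_scope.
Context (R : realType) (n m : nat).
Variables (h : continuousType 'cV[R]_n 'cV[R]_m) (Gamma : 'M[R]_m).
Variables (c : {posnum R}) (y : 'cV[R]_m).
Variable (mu : {measure set 'cV[R]_n -> \bar R}).

Definition weighted (B : set 'cV[R]_n) : \bar R :=
  \int[mu]_(v in B) (likelihood h Gamma c y v)%:E.

Let weighted0 : weighted set0 = 0.
Proof. exact: integral_set0. Qed.

Let weighted_ge0 B : 0 <= weighted B.
Proof. by apply: integral_ge0 => v _; rewrite lee_fin ltW// likelihood_gt0. Qed.

Let weighted_sigma_additive : semi_sigma_additive weighted.
Proof.
move=> F mF tF mUF; rewrite /weighted ge0_integral_bigcup//.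
- by apply: is_cvg_ereal_nneg_natsum => k _; exact: weighted_ge0.
- by apply/measurable_funTS/measurable_EFinP; exact: measurable_likelihood.
- by move=> v _; rewrite lee_fin ltW// likelihood_gt0.
Qed.

HB.instance Definition _ := isMeasure.Build _ _ _ weighted
  weighted0 weighted_ge0 weighted_sigma_additive.

(* \d_0 is the default of mnormalize, for a normalizing constant 0 or +oo *)
Definition analysis : probability 'cV[R]_n R :=
  mnormalize weighted \d_(0%R : 'cV[R]_n).

End analysis.

Section empirical.
Local Open Scope ereal_scope.
Context d (T : measurableType d) (R : realType) (N : nat) (x : 'I_N -> T).

Definition empirical (B : set T) : \bar R :=
  (N%:R^-1)%:E * \sum_(i < N) \d_(x i) B.

Let empirical0 : empirical set0 = 0.
Proof. by rewrite /empirical big1 ?mule0// => i _; rewrite measure0. Qed.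

Let empirical_ge0 B : 0 <= empirical B.
Proof. by rewrite mule_ge0// ?lee_fin// sume_ge0. Qed.

Let empirical_sigma_additive : semi_sigma_additive empirical.
Proof.
move=> F mF tF mUF; rewrite /empirical.
rewrite [X in X @ _ --> _](_ : _ = (fun k => (N%:R^-1)%:E *
    \sum_(i < N) \sum_(0 <= j < k) \d_(x i) (F j))); last first.
  apply/funext => k; rewrite exchange_big/= ge0_sume_distrr// => j _.
  by rewrite sume_ge0.
apply: cvgeZl => //; apply: cvg_nnesum => i _.
  by near=> k; exact: sume_ge0.
exact: measure_semi_sigma_additive.
Unshelve. all: by end_near. Qed.

HB.instance Definition _ := isMeasure.Build _ _ _ empirical
  empirical0 empirical_ge0 empirical_sigma_additive.

End empirical.
Arguments empirical {d T R N}.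

Section filters.
Context (R : realType) (n m : nat).
Variables (Psi : continuousType 'cV[R]_n 'cV[R]_n).
Variables (h : continuousType 'cV[R]_n 'cV[R]_m).
Variables (m0 : 'cV[R]_n) (C0 Sigma : 'M[R]_n) (Gamma : 'M[R]_m).
Variables (c : nat -> {posnum R}) (y : nat -> 'cV[R]_m).

(* The step from j to j+1 uses the datum y_{j+1}; y 0 is never used. *)
Local Notation L j := (analysis h Gamma (c j) (y j.+1)).
Local Notation P := (predict (transition Psi Sigma)).

Fixpoint filtering j : probability 'cV[R]_n R :=
  if j is i.+1 then L i (P (filtering i)) else gaussian m0 C0.

Section particles.
Context (N : nat) d (Omega : measurableType d) (Pr : probability Omega R).

(* v j k w is the k-th sample drawn at step j (k < N), so that
   empirical (v j ^~ w) is the realization of S^N P mu_j^N. *)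
Variable v : nat -> 'I_N -> Omega -> 'cV[R]_n.

Definition particle_filter j (w : Omega) : probability 'cV[R]_n R :=
  if j is i.+1 then L i (empirical (v i ^~ w)) else gaussian m0 C0.

(* sigma-algebra generated by the samples drawn before step j *)
Definition past j : set_system Omega :=
  <<s [set A | exists i k B, [/\ (i < j)%N, measurable B & A = v i k @^-1` B]] >>.

(* Given the past, the samples of step j are i.i.d. with law P mu_j^N. *)
Definition fresh_samples :=
  (forall j k, measurable_fun setT (v j k)) /\
  forall j (A : set Omega) (B : 'I_N -> set 'cV[R]_n),
    past j A -> (forall k, measurable (B k)) ->
    Pr (A `&` \bigcap_k (v j k @^-1` B k)) =
    (\int[Pr]_(w in A) \prod_(k < N) P (particle_filter j w) (B k))%E.

End particles.
End filters.

(* The distance d(mu, nu) between random probability measures *)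
Definition rpm_dist d (Omega : measurableType d) (R : realType)
    (Pr : probability Omega R) d' (T : measurableType d')
    (mu nu : Omega -> probability T R) : \bar R :=
  ereal_sup [set sqrte
      ('E_Pr[fun w => (`|\int[mu w]_u f u - \int[nu w]_u f u| ^+ 2)%R])%E
    | f in [set f : T -> R | measurable_fun setT f /\ forall u, `|f u| <= 1]].

(* Main.v *)
Require Import Defs.
From HB Require Import structures.
From mathcomp Require Import all_boot all_order all_algebra.
From mathcomp Require Import all_classical all_reals all_analysis measurable_realfun.
From mathcomp Require Import ring.

(* Write S f for the empirical mean of f over the N samples drawn from the random
   measure q = P mu_j^N.  Distinct samples are conditionally independent given q,
   so E[S f] = E[q f] and, for every constant a,
     E (S f - a)^2 = E (q f - a)^2 + N^-1 E[q (f^2) - (q f)^2].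
   With a = (P mu_j) f this adds at most 1/N to the squared error and makes
   conditioning on the past superfluous.  The likelihood update multiplies the
   L^2 error by at most r = 2 kappa^-2, as one sees by testing it against
   kappa g and kappa g f, and r^2 (1/N + s^2) <= (r / sqrt N + r s)^2 closes the
   induction on J. *)

Set Implicit Arguments.
Unset Strict Implicit.
Unset Printing Implicit Defensive.

Import Order.TTheory GRing.Theory Num.Theory.
Import numFieldNormedType.Exports.

Local Open Scope classical_set_scope.
Local Open Scope ring_scope.

(** * Integrals against mixtures of a family of measures *)

Section mixture.
Local Open Scope ereal_scope.
Context d d' (X : measurableType d) (T : measurableType d') (R : realType).
Variables (mu : {measure set X -> \bar R}) (Y : X -> R).
Variable k : X -> {measure set T -> \bar R}.
Hypothesis Y0 : forall x, (0 <= Y x)%R.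
Hypothesis mY : measurable_fun setT Y.
Hypothesis mk : forall B, measurable B -> measurable_fun setT (k ^~ B).

Import HBNNSimple.

(** For a simple [h] the inner integral is a finite sum over the range, so it commutes with the
    outer one. Hence the left side depends on [mu], [Y] and [k] only through the masses of sets
    under the mixture. *)
Lemma mixture_nnsfun (h : {nnsfun T >-> R}) :
  \int[mu]_x ((Y x)%:E * \int[k x]_t (h t)%:E) =
  \sum_(r \in range h) r%:E * \int[mu]_x ((Y x)%:E * k x (h @^-1` [set r])).
Proof.
have mh r : measurable (h @^-1` [set r]).
  exact: measurable_funPTI.
have mYk r : measurable_fun setT (fun x => (Y x)%:E * k x (h @^-1` [set r])).
  by apply: emeasurable_funM; [exact/measurable_EFinP|exact: mk].
have h0 x r : 0 <= r%:E * k x (h @^-1` [set r]) by exact: nnsfun_mulemu_ge0.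
under eq_integral do rewrite integralT_nnsfun sintegralE (ge0_mule_fsumr _ _ (h0 _)).
rewrite ge0_integral_fsum//.
- apply: eq_fsbigr => r rh.
  under eq_integral do rewrite muleCA.
  rewrite ge0_integralZl//.
  + by move=> x _; rewrite mule_ge0 ?lee_fin.
  + by move: rh; rewrite inE => -[t _ <-]; rewrite lee_fin.
- move=> r; under eq_fun do rewrite muleCA.
  exact: emeasurable_funM.
- by move=> r x _; rewrite mule_ge0 ?lee_fin// nnsfun_mulemu_ge0.
Qed.

(** Monotone convergence is applied twice, inside for each [k x] and then outside; the weight [Y] is
    nonnegative, so it preserves monotonicity. *)
Lemma mixture_lim (F : T -> \bar R) (F0 : forall t, 0 <= F t)
    (mF : measurable_fun setT F) :
  \int[mu]_x ((Y x)%:E * \int[k x]_t F t) =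
  limn (fun n => \int[mu]_x ((Y x)%:E * \int[k x]_t (nnsfun_approx measurableT mF n t)%:E)).
Proof.
pose F_ := nnsfun_approx measurableT mF.
have nd x : {homo (fun n => \int[k x]_t (F_ n t)%:E) : a b / (a <= b)%N >-> a <= b}.
  move=> a b ab; apply: ge0_le_integral => //.
  - by move=> t _; rewrite lee_fin.
  - exact/measurable_EFinP.
  - exact/measurable_EFinP.
  - by move=> t _; rewrite lee_fin; exact/lefP/nd_nnsfun_approx.
rewrite -monotone_convergence//.
- apply: eq_integral => x _.
  have -> : \int[k x]_t F t = limn (fun n => \int[k x]_t (F_ n t)%:E).
    rewrite -monotone_convergence//.
    + by apply: eq_integral => t _; apply/esym/cvg_lim => //; exact: cvg_nnsfun_approx.
    + by move=> n; exact/measurable_EFinP.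
    + by move=> n t _; rewrite lee_fin.
    + by move=> t _ a b ab; rewrite lee_fin; exact/lefP/nd_nnsfun_approx.
  by rewrite limeMl//; apply: ereal_nondecreasing_is_cvgn; exact: nd.
- move=> n; apply: emeasurable_funM; first exact/measurable_EFinP.
  apply: measurable_fun_integral_kernel => //; first by move=> z; rewrite lee_fin.
  exact/measurable_EFinP.
- by move=> n x _; rewrite mule_ge0 ?lee_fin// integral_ge0// => t _; rewrite lee_fin.
- by move=> x _ a b ab; rewrite lee_wpmul2l ?lee_fin//; exact: nd.
Qed.

End mixture.

Section mixture_transfer.
Local Open Scope ereal_scope.
Context d1 d2 d (X1 : measurableType d1) (X2 : measurableType d2)
  (T : measurableType d) (R : realType).
Variables (mu1 : {measure set X1 -> \bar R}) (mu2 : {measure set X2 -> \bar R}).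
Variables (Y1 : X1 -> R) (Y2 : X2 -> R).
Variables (k1 : X1 -> {measure set T -> \bar R}).
Variables (k2 : X2 -> {measure set T -> \bar R}).
Hypotheses (Y1_ge0 : forall x, (0 <= Y1 x)%R) (Y2_ge0 : forall x, (0 <= Y2 x)%R).
Hypotheses (mY1 : measurable_fun setT Y1) (mY2 : measurable_fun setT Y2).
Hypothesis mk1 : forall B, measurable B -> measurable_fun setT (k1 ^~ B).
Hypothesis mk2 : forall B, measurable B -> measurable_fun setT (k2 ^~ B).

Import HBNNSimple.

(** Both sides are limits along the same simple approximations, which depend on [F] alone, and at
    each stage they are the same combination of masses of sets. This turns set-wise descriptions of
    laws into identities between integrals. *)
Lemma mixture_transfer :
  (forall B, measurable B -> \int[mu1]_x ((Y1 x)%:E * k1 x B) =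
                             \int[mu2]_x ((Y2 x)%:E * k2 x B)) ->
  forall F : T -> \bar R, (forall t, 0 <= F t) -> measurable_fun setT F ->
  \int[mu1]_x ((Y1 x)%:E * \int[k1 x]_t F t) =
  \int[mu2]_x ((Y2 x)%:E * \int[k2 x]_t F t).
Proof.
move=> k12 F F0 mF.
rewrite (mixture_lim mu1 Y1_ge0 mY1 mk1 F0 mF) (mixture_lim mu2 Y2_ge0 mY2 mk2 F0 mF).
congr (limn _); apply/funext => n.
rewrite (mixture_nnsfun mu1)// (mixture_nnsfun mu2)//.
apply: eq_fsbigr => r _; rewrite k12//; exact: measurable_funPTI.
Qed.

End mixture_transfer.

(** * Bounded measurable functions and their real-valued integrals *)

Definition bmeas d (T : measurableType d) (R : realType) (f : T -> R) :=
  measurable_fun setT f /\ exists M, forall x, `|f x| <= M.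

Section bmeas.
Context d (T : measurableType d) (R : realType).
Implicit Types f g : T -> R.

Lemma bmeas_cst (a : R) : bmeas (fun _ : T => a).
Proof. by split; [exact: measurable_cst|exists `|a|]. Qed.

Lemma bmeasD f g : bmeas f -> bmeas g -> bmeas (fun x => f x + g x).
Proof.
move=> [mf [M fM]] [mg [K gK]]; split; first exact: measurable_funD.
by exists (M + K) => x; rewrite (le_trans (ler_normD _ _))// lerD.
Qed.

Lemma bmeasM f g : bmeas f -> bmeas g -> bmeas (fun x => f x * g x).
Proof.
move=> [mf [M fM]] [mg [K gK]]; split; first exact: measurable_funM.
by exists (M * K) => x; rewrite normrM ler_pM.
Qed.

Lemma bmeasZ (a : R) f : bmeas f -> bmeas (fun x => a * f x).
Proof. by move=> bf; apply: bmeasM => //; exact: bmeas_cst. Qed.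

Lemma bmeasB f g : bmeas f -> bmeas g -> bmeas (fun x => f x - g x).
Proof.
move=> bf bg; under eq_fun do rewrite -mulN1r; apply: bmeasD => //.
exact: bmeasZ.
Qed.

Lemma bmeasX f n : bmeas f -> bmeas (fun x => f x ^+ n).
Proof.
move=> bf; elim: n => [|n ih]; first exact: bmeas_cst.
by under eq_fun do rewrite exprS; exact: bmeasM.
Qed.

Lemma bmeas_sum I (s : seq I) (F : I -> T -> R) :
  (forall i, bmeas (F i)) -> bmeas (fun x => \sum_(i <- s) F i x).
Proof.
move=> bF; elim: s => [|i s ih].
  by under eq_fun do rewrite big_nil; exact: bmeas_cst.
by under eq_fun do rewrite big_cons; exact: bmeasD.
Qed.

Lemma bmeas_comp d' (X : measurableType d') f (u : X -> T) :
  measurable_fun setT u -> bmeas f -> bmeas (f \o u).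
Proof.
move=> mu [mf [M fM]]; split; first exact: measurableT_comp.
by exists M => x; exact: fM.
Qed.

Lemma bmeas_indic (B : set T) : measurable B -> bmeas (\1_B : T -> R).
Proof.
move=> mB; split; first exact: measurable_indic.
by exists 1 => x; rewrite indicE; case: (_ \in _); rewrite ?normr1 ?normr0.
Qed.

Section finite.
Variable mu : {measure set T -> \bar R}.
Hypothesis mu_fin : (mu setT < +oo)%E.

Lemma bmeas_integrable f : bmeas f -> mu.-integrable setT (EFin \o f).
Proof.
move=> [mf [M fM]]; apply: measurable_bounded_integrable => //.
exists M; split; first by rewrite num_real.
by move=> x Mx y _ /=; rewrite (le_trans (fM y))// ltW.
Qed.

Lemma bmeas_fineK f : bmeas f -> (\int[mu]_x (f x)%:E = (\int[mu]_x f x)%:E)%E.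
Proof. by move=> bf; rewrite /Rintegral fineK//; exact: integrable_fin_num (bmeas_integrable bf). Qed.

Lemma bmeas_RintegralD f g : bmeas f -> bmeas g ->
  \int[mu]_x (f x + g x) = \int[mu]_x f x + \int[mu]_x g x.
Proof. by move=> bf bg; rewrite RintegralD//; exact: bmeas_integrable. Qed.

Lemma bmeas_RintegralB f g : bmeas f -> bmeas g ->
  \int[mu]_x (f x - g x) = \int[mu]_x f x - \int[mu]_x g x.
Proof. by move=> bf bg; rewrite RintegralB//; exact: bmeas_integrable. Qed.

Lemma bmeas_RintegralZ a f : bmeas f ->
  \int[mu]_x (a * f x) = a * \int[mu]_x f x.
Proof. by move=> bf; rewrite RintegralZl//; exact: bmeas_integrable. Qed.

Lemma bmeas_Rintegral_sum I (s : seq I) (F : I -> T -> R) :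
  (forall i, bmeas (F i)) ->
  \int[mu]_x (\sum_(i <- s) F i x) = \sum_(i <- s) \int[mu]_x F i x.
Proof.
move=> bF; elim: s => [|i s ih].
  by rewrite big_nil; under eq_Rintegral do rewrite big_nil; rewrite Rintegral_cst// mul0r.
rewrite big_cons -ih -bmeas_RintegralD//; last exact: bmeas_sum.
by apply: eq_Rintegral => x _; rewrite big_cons.
Qed.

Lemma bmeas_le_Rintegral f g : bmeas f -> bmeas g -> (forall x, f x <= g x) ->
  \int[mu]_x f x <= \int[mu]_x g x.
Proof.
by move=> bf bg fg; apply: le_Rintegral => //; exact: bmeas_integrable.
Qed.

End finite.

Section total_mass_one.
Variable mu : {measure set T -> \bar R}.
Hypothesis mu1 : mu setT = 1%E.

Let mu_fin : (mu setT < +oo)%E. Proof. by rewrite mu1 ltry. Qed.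

Lemma mass1_Rintegral_cst a : \int[mu]_x a = a.
Proof. by rewrite Rintegral_cst// mu1 mulr1. Qed.

Lemma mass1_RintegralDr f a : bmeas f -> \int[mu]_x (f x + a) = \int[mu]_x f x + a.
Proof.
move=> bf; rewrite bmeas_RintegralD// ?mass1_Rintegral_cst//; exact: bmeas_cst.
Qed.

Lemma mass1_normr_Rintegral f M : bmeas f -> (forall x, `|f x| <= M) ->
  `|\int[mu]_x f x| <= M.
Proof.
move=> bf fM; rewrite ler_norml.
rewrite -[X in X <= _ <= _]mass1_Rintegral_cst -[X in _ <= _ <= X]mass1_Rintegral_cst.
by apply/andP; split; apply: bmeas_le_Rintegral => //; try exact: bmeas_cst;
  move=> x; have := fM x; rewrite ler_norml => /andP[].
Qed.

End total_mass_one.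

End bmeas.

Lemma Rintegral_dirac d (T : measurableType d) (R : realType) (a : T) (f : T -> R) :
  measurable_fun setT f -> \int[\d_a]_x f x = f a.
Proof.
move=> mf; rewrite /Rintegral integral_dirac//; last exact/measurable_EFinP.
by rewrite diracT mul1e.
Qed.

(** * Probability kernels and the transfer of real-valued integrals *)

Section probability_kernel.
Context d d' (X : measurableType d) (T : measurableType d') (R : realType).
Variable k : X -> {measure set T -> \bar R}.
Hypothesis mk : forall B, measurable B -> measurable_fun setT (k ^~ B).
Hypothesis k1 : forall x, k x setT = 1%E.

(** Measurability in [x] comes from the nonnegative integrand [f + M]; since each [k x] has mass
    one, the shift is undone by subtracting exactly [M]. *)
Lemma bmeas_kernel (f : T -> R) : bmeas f -> bmeas (fun x => \int[k x]_t f t).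
Proof.
move=> bf; have [mf [M fM]] := bf.
split; last by exists M => x; exact: mass1_normr_Rintegral.
have -> : (fun x => \int[k x]_t f t) = (fun x => \int[k x]_t (f t + M) - M).
  by apply/funext => x; rewrite mass1_RintegralDr// addrK.
apply: measurable_funB => //.
rewrite /Rintegral; apply: measurableT_comp => //.
apply: measurable_fun_integral_kernel => //.
  by move=> t; rewrite lee_fin -lerBlDr sub0r; have := fM t; rewrite ler_norml => /andP[].
by apply/measurable_EFinP; exact: measurable_funD.
Qed.

Lemma mass1_fineK x B : measurable B -> ((fine (k x B))%:E = k x B)%E.
Proof.
move=> mB; rewrite fineK// ge0_fin_numE// (le_lt_trans _ (ltry 1))//.
by rewrite -(k1 x) le_measure// inE.
Qed.

Lemma bmeas_kernel_fine B : measurable B -> bmeas (fun x => fine (k x B)).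
Proof.
move=> mB; have := bmeas_kernel (bmeas_indic R mB); congr bmeas.
by apply/funext => x; rewrite /Rintegral integral_indic// setIT.
Qed.

End probability_kernel.

Section Rintegral_transfer.
Context d1 d2 d (X1 : measurableType d1) (X2 : measurableType d2)
  (T : measurableType d) (R : realType).
Variables (mu1 : {measure set X1 -> \bar R}) (mu2 : {measure set X2 -> \bar R}).
Variables (Y1 : X1 -> R) (Y2 : X2 -> R).
Variables (k1 : X1 -> {measure set T -> \bar R}).
Variables (k2 : X2 -> {measure set T -> \bar R}).
Hypotheses (mu1_fin : (mu1 setT < +oo)%E) (mu2_fin : (mu2 setT < +oo)%E).
Hypotheses (bY1 : bmeas Y1) (bY2 : bmeas Y2).
Hypotheses (Y1_ge0 : forall x, 0 <= Y1 x) (Y2_ge0 : forall x, 0 <= Y2 x).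
Hypothesis mk1 : forall B, measurable B -> measurable_fun setT (k1 ^~ B).
Hypothesis mk2 : forall B, measurable B -> measurable_fun setT (k2 ^~ B).
Hypotheses (k1T : forall x, k1 x setT = 1%E) (k2T : forall x, k2 x setT = 1%E).

(** The signed form of [mixture_transfer], again by shifting [f] to the nonnegative [F]. It is meant
    for Dirac kernels on one side: expectations of functions of a sample then follow from
    probabilities of events. *)
Lemma Rintegral_transfer :
  (forall B, measurable B -> \int[mu1]_x (Y1 x * fine (k1 x B)) =
                             \int[mu2]_x (Y2 x * fine (k2 x B))) ->
  forall f : T -> R, bmeas f ->
  \int[mu1]_x (Y1 x * \int[k1 x]_t f t) = \int[mu2]_x (Y2 x * \int[k2 x]_t f t).
Proof.
move=> k12 f bf; have [mY1 _] := bY1; have [mY2 _] := bY2.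
have [mf [M fM]] := bf.
pose F t := f t + M.
have bF : bmeas F by apply: bmeasD => //; exact: bmeas_cst.
have F0 t : (0 <= (F t)%:E)%E.
  by rewrite lee_fin -lerBlDr sub0r; have := fM t; rewrite ler_norml => /andP[].
have mF : measurable_fun setT (fun t => (F t)%:E).
  by apply/measurable_EFinP; case: bF.
(* Everything is bounded and [mu] is finite, so extended and real integrals agree; the shift
   contributes [M] times the total weight. *)
have toE d0 (X : measurableType d0) (mu : {measure set X -> \bar R}) Y
    (k : X -> {measure set T -> \bar R}) : (mu setT < +oo)%E -> bmeas Y ->
    (forall B, measurable B -> measurable_fun setT (k ^~ B)) ->
    (forall x, k x setT = 1%E) ->
    ((forall B, measurable B ->
       \int[mu]_x ((Y x)%:E * k x B) = (\int[mu]_x (Y x * fine (k x B)))%:E) /\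
     (\int[mu]_x ((Y x)%:E * \int[k x]_t (F t)%:E) =
       (\int[mu]_x (Y x * \int[k x]_t f t) + M * \int[mu]_x Y x)%:E))%E.
  move=> muoo bY mk kT; split=> [B mB|].
    rewrite -bmeas_fineK//; last by apply: bmeasM => //; exact: bmeas_kernel_fine.
    by apply: eq_integral => x _; rewrite EFinM mass1_fineK.
  have koo x : (k x setT < +oo)%E by rewrite kT ltry.
  have bk := bmeas_kernel mk kT bf.
  rewrite -bmeas_RintegralZ// -bmeas_RintegralD//; [|exact: bmeasM|exact: bmeasZ].
  rewrite -bmeas_fineK//; last by apply: bmeasD; [exact: bmeasM|exact: bmeasZ].
  apply: eq_integral => x _; rewrite bmeas_fineK// mass1_RintegralDr// -EFinM.
  by rewrite mulrDr (mulrC M).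
have [E1 F1] := toE _ _ _ _ _ mu1_fin bY1 mk1 k1T.
have [E2 F2] := toE _ _ _ _ _ mu2_fin bY2 mk2 k2T.
have E12 B : measurable B ->
    (\int[mu1]_x ((Y1 x)%:E * k1 x B) = \int[mu2]_x ((Y2 x)%:E * k2 x B))%E.
  by move=> mB; rewrite E1// E2// k12.
have := mixture_transfer Y1_ge0 Y2_ge0 mY1 mY2 mk1 mk2 E12 F0 mF.
rewrite F1 F2 => /eqP; rewrite eqe => /eqP.
(* The hypothesis at [setT] equates the total weights, so the two shift terms cancel. *)
have : \int[mu1]_x Y1 x = \int[mu2]_x Y2 x.
  have := k12 _ measurableT.
  under eq_Rintegral do rewrite k1T mulr1.
  by under [RHS]eq_Rintegral do rewrite k2T mulr1.
by move=> -> /addIr.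
Qed.

End Rintegral_transfer.

(** Any [m] is the mixture over itself of the Dirac masses, so [Rintegral_transfer] compares this
    trivial mixture with the given one. The integral formulas for [predict] and [analysis] are both
    instances. *)
Lemma Rintegral_mixture d d' (X : measurableType d) (T : measurableType d')
    (R : realType) (k : X -> {measure set T -> \bar R})
    (mu : {measure set X -> \bar R}) (Y : X -> R) (m : {measure set T -> \bar R}) :
  (forall B, measurable B -> measurable_fun setT (k ^~ B)) ->
  (forall x, k x setT = 1%E) ->
  (mu setT < +oo)%E -> bmeas Y -> (forall x, 0 <= Y x) ->
  (forall B, measurable B -> m B = \int[mu]_x ((Y x)%:E * k x B))%E ->
  forall f : T -> R, bmeas f ->
  \int[m]_t f t = \int[mu]_x (Y x * \int[k x]_t f t).
Proof.
move=> mk k1 muoo bY Y0 mE f bf; have [mf _] := bf.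
have mB B : measurable B -> m B = (\int[mu]_x (Y x * fine (k x B)))%:E.
  move=> mB; rewrite mE// -bmeas_fineK//; last first.
    by apply: bmeasM => //; exact: bmeas_kernel_fine.
  by apply: eq_integral => x _; rewrite EFinM mass1_fineK.
transitivity (\int[m]_t (1 * \int[\d_t]_u f u)).
  by apply: eq_Rintegral => t _; rewrite mul1r Rintegral_dirac.
apply: Rintegral_transfer => //.
- by rewrite mB// ltry.
- exact: bmeas_cst.
- by move=> B mB'; exact: measurable_fun_dirac.
- by move=> t; rewrite /= diracT.
move=> B mB'; transitivity (\int[m]_t (\1_B t)).
  by apply: eq_Rintegral => t _; rewrite mul1r.
by rewrite /Rintegral integral_indic// setIT mB.
Qed.

(** * Integrals against predicted, empirical and updated measures *)

Lemma Rintegral_predict d (T : measurableType d) (R : realType)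
    (p : R.-pker T ~> T) (mu : probability T R) (f : T -> R) : bmeas f ->
  \int[predict p mu]_u f u = \int[mu]_u \int[p u]_t f t.
Proof.
move=> bf; rewrite (@Rintegral_mixture _ _ T T R p mu (cst 1))//.
- by apply: eq_Rintegral => u _; rewrite mul1r.
- by move=> B mB; exact: measurable_kernel.
- by move=> u; exact: prob_kernel.
- by rewrite [X in (X < _)%E]probability_setT ltry.
- exact: bmeas_cst.
- by move=> B mB; rewrite /= /predict; apply: eq_integral => u _; rewrite mul1e.
Qed.

Section empirical_integral.
Context d (T : measurableType d) (R : realType) (N : nat) (x : 'I_N.+1 -> T).

Lemma empirical_setT : empirical x setT = 1%E :> \bar R.
Proof.
rewrite /empirical; under eq_bigr do rewrite diracT.
by rewrite sumEFin -EFinM sumr_const card_ord mulVf.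
Qed.

Lemma Rintegral_empirical (f : T -> R) : bmeas f ->
  \int[empirical x]_u f u = N.+1%:R^-1 * \sum_(i < N.+1) f (x i).
Proof.
move=> bf; have [mf [M fM]] := bf.
have F0 t : (0 <= (f t + M)%:E)%E.
  by rewrite lee_fin -lerBlDr sub0r; have := fM t; rewrite ler_norml => /andP[].
have mF : measurable_fun setT (fun t => (f t + M)%:E).
  by apply/measurable_EFinP; apply: measurable_funD.
have bF : bmeas (fun t => f t + M) by apply: bmeasD => //; exact: bmeas_cst.
have N0 : 0 <= N.+1%:R^-1 :> R by rewrite invr_ge0.
(* [msum] is indexed by natural numbers, so the sample index is read through [inord], which is the
   identity below [N.+1]. *)
pose m : {measure set T -> \bar R} :=
  mscale (NngNum N0) (msum (fun k => \d_(x (inord k))) N.+1).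
have E1 : (\int[empirical x]_u (f u + M)%:E =
    (N.+1%:R^-1 * \sum_(i < N.+1) (f (x i) + M))%:E)%E.
  rewrite (@eq_measure_integral _ _ _ _ m); last first.
    move=> A mA _; rewrite /m /mscale /= /msum /empirical; congr (_ * _)%E.
    by apply: eq_bigr => i _; rewrite inord_val.
  rewrite ge0_integral_mscale// ge0_integral_measure_sum//= EFinM -sumEFin.
  congr (_ * _)%E; apply: eq_bigr => i _.
  by rewrite integral_dirac// diracT mul1e inord_val.
apply: (addIr M); rewrite -mass1_RintegralDr//; last exact: empirical_setT.
rewrite /Rintegral E1/= big_split/= mulrDr; congr (_ + _).
by rewrite sumr_const card_ord -[in M *+ _]mulr_natl mulKf.
Qed.

End empirical_integral.

Section analysis_integral.
Context (R : realType) (n m : nat).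
Variables (h : continuousType 'cV[R]_n 'cV[R]_m) (Gamma : 'M[R]_m).
Variables (c : {posnum R}) (y : 'cV[R]_m) (kappa : R).
Local Notation g := (likelihood h Gamma c y).
Hypothesis kappa_gt0 : 0 < kappa.
Hypothesis g_bound : forall u, kappa <= g u <= kappa^-1.

Lemma bmeas_likelihood : bmeas g.
Proof.
split; first exact: measurable_likelihood.
exists kappa^-1 => u; rewrite ger0_norm ?(ltW (likelihood_gt0 _ _ _ _ _))//.
by case/andP: (g_bound u).
Qed.

Variable mu : {measure set 'cV[R]_n -> \bar R}.
Hypothesis mu1 : mu setT = 1%E.

(** This keeps the normalizing constant of the update away from 0. *)
Lemma Rintegral_likelihood_ge : kappa <= \int[mu]_u g u.
Proof.
rewrite -[leLHS](mass1_Rintegral_cst mu1); apply: bmeas_le_Rintegral.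
- by rewrite [X in (X < _)%E]mu1 ltry.
- exact: bmeas_cst.
- exact: bmeas_likelihood.
- by move=> u; case/andP: (g_bound u).
Qed.

(** The updated measure is the mixture over [mu] of Dirac masses with weight [g u / C], so
    [Rintegral_mixture] applies. *)
Lemma Rintegral_analysis (f : 'cV[R]_n -> R) : bmeas f ->
  \int[analysis h Gamma c y mu]_u f u =
  (\int[mu]_u (g u * f u)) / \int[mu]_u g u.
Proof.
move=> bf; have bg := bmeas_likelihood.
set C := \int[mu]_u g u.
have C0 : 0 < C := lt_le_trans kappa_gt0 Rintegral_likelihood_ge.
have muoo : (mu setT < +oo)%E by rewrite mu1 ltry.
have wT : weighted h Gamma c y mu setT = C%:E by rewrite /weighted bmeas_fineK.
(* [C] is positive and finite, so [mnormalize] does not fall back on its default measure. *)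
have wT0 : (weighted h Gamma c y mu setT == 0%E) ||
    (weighted h Gamma c y mu setT == +oo%E) = false.
  by rewrite wT eqe gt_eqF.
rewrite (@Rintegral_mixture _ _ _ _ R (fun u => \d_u) mu (fun u => C^-1 * g u)
  (analysis h Gamma c y mu))//.
- rewrite mulrC -bmeas_RintegralZ//; last exact: bmeasM.
  by apply: eq_Rintegral => u _; rewrite Rintegral_dirac ?mulrA//; case: bf.
- by move=> B mB; exact: measurable_fun_dirac.
- by move=> u; rewrite /= diracT.
- exact: bmeasZ.
- by move=> u; rewrite mulr_ge0 ?invr_ge0 ?ltW// likelihood_gt0.
move=> B mB; rewrite /analysis /= /mnormalize ifF; last exact: wT0.
rewrite [fine _](_ : _ = C); last first.
  by rewrite -[RHS]/(fine C%:E); congr fine; exact: wT.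
rewrite muleC /weighted -ge0_integralZl//; first last.
- by rewrite lee_fin invr_ge0 ltW.
- by move=> u _; rewrite lee_fin ltW// likelihood_gt0.
- by apply: measurable_funTS; apply/measurable_EFinP; case: bg.
rewrite [LHS]integral_mkcond.
apply: eq_integral => u _; rewrite patchE diracE EFinM.
by case: (_ \in _); rewrite ?mule1 ?mule0.
Qed.

End analysis_integral.

(** * Moments of a sample drawn from a random measure *)

Section sampling.
Context d d' (Omega : measurableType d) (T : measurableType d') (R : realType).
Variables (Pr : probability Omega R) (N : nat) (v : 'I_N.+1 -> Omega -> T).
Variable pi : Omega -> {measure set T -> \bar R}.
Hypothesis mv : forall k, measurable_fun setT (v k).
Hypothesis mpi : forall B, measurable B -> measurable_fun setT (pi ^~ B).
Hypothesis pi1 : forall w, pi w setT = 1%E.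
Hypothesis iid : forall B : 'I_N.+1 -> set T, (forall k, measurable (B k)) ->
  Pr (\bigcap_k (v k @^-1` B k)) = (\int[Pr]_w \prod_(k < N.+1) pi w (B k))%E.

Let Pr_fin : (Pr setT < +oo)%E. Proof. by rewrite probability_setT ltry. Qed.

Let mdirac k B : measurable B -> measurable_fun setT (fun w => \d_(v k w) B : \bar R).
Proof. by move=> mB; exact: measurableT_comp (measurable_fun_dirac mB) (mv k). Qed.

Let mpre k B : measurable B -> measurable (v k @^-1` B).
Proof. by move=> mB; rewrite -[X in measurable X]setTI; exact: mv. Qed.

(** In [iid] every other coordinate receives [setT], whose factor in the product is 1. *)
Let law1 k B : measurable B ->
  \int[Pr]_w \1_B (v k w) = \int[Pr]_w fine (pi w B).
Proof.
move=> mB; have H := iid (B := fun i => if i == k then B else setT).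
transitivity (fine (Pr (v k @^-1` B))).
  rewrite -[in RHS](setIT (_ @^-1` _)) -integral_indic//; exact: mpre.
congr fine.
rewrite (_ : _ @^-1` B = \bigcap_i (v i @^-1` (if i == k then B else setT))); last first.
  apply/seteqP; split=> [w vB i _|w /(_ k I)]; last by rewrite /= eqxx.
  by rewrite /=; case: eqP => [->|].
rewrite {}H; last by move=> i; case: ifP.
apply: eq_integral => w _; rewrite (bigD1 k)//= eqxx big1 ?mule1.
  by rewrite (mass1_fineK pi1).
by move=> i /negbTE ->.
Qed.

(** The samples are independent given [pi w], so the two masses stand under one integral; the
    remaining coordinates receive [setT] as before. *)
Let law2 k l B C : k != l -> measurable B -> measurable C ->
  \int[Pr]_w (\1_C (v l w) * \1_B (v k w)) =
  \int[Pr]_w (fine (pi w C) * fine (pi w B)).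
Proof.
move=> kl mB mC.
pose D i := if i == k then B else if i == l then C else setT.
have mD i : measurable (D i) by rewrite /D; case: ifP => // _; case: ifP.
have H := iid mD.
transitivity (fine (Pr (v l @^-1` C `&` v k @^-1` B))).
  rewrite -[in RHS](setIT (_ `&` _)) -integral_indic//.
    by apply: eq_Rintegral => w _; rewrite indicI.
  by apply: measurableI; exact: mpre.
congr fine.
rewrite (_ : _ `&` _ = \bigcap_i (v i @^-1` D i)); last first.
  apply/seteqP; split=> [w [vC vB] i _|w vD]; last first.
    split; first by have := vD l I; rewrite /= /D eq_sym (negbTE kl) eqxx.
    by have := vD k I; rewrite /= /D eqxx.
  by rewrite /= /D; case: eqP => [->//|_]; case: eqP => [->|].
rewrite {}H; apply: eq_integral => w _.
rewrite (bigD1 k)//= (bigD1 l) 1?eq_sym//= big1 ?mule1.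
  rewrite /D eqxx eq_sym (negbTE kl) eqxx EFinM muleC.
  by rewrite !(mass1_fineK pi1).
by move=> i /andP[/negbTE ik /negbTE il]; rewrite /D ik il pi1.
Qed.

(** By [law1] the Dirac kernel at [v k w] and the kernel [pi w] have the same mixture under [Pr]. *)
Lemma sample_mean k (f : T -> R) : bmeas f ->
  \int[Pr]_w f (v k w) = \int[Pr]_w \int[pi w]_t f t.
Proof.
move=> bf; have [mf _] := bf.
transitivity (\int[Pr]_w (1 * \int[\d_(v k w)]_t f t)).
  by apply: eq_Rintegral => w _; rewrite mul1r Rintegral_dirac.
rewrite (@Rintegral_transfer _ _ _ _ _ _ _ Pr Pr (cst 1) (cst 1)
  (fun w => \d_(v k w)) pi)//.
- by apply: eq_Rintegral => w _; rewrite mul1r.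
- exact: bmeas_cst.
- exact: bmeas_cst.
- by move=> B mB; exact: mdirac.
- by move=> w; rewrite /= diracT.
move=> B mB; transitivity (\int[Pr]_w \1_B (v k w)).
  by apply: eq_Rintegral => w _; rewrite mul1r.
by rewrite law1//; apply: eq_Rintegral => w _; rewrite mul1r.
Qed.

(** The two samples are replaced by [pi w] one at a time: sample [l] with weight [f (v k w)], where
    the hypothesis of the transfer for a set [C] is itself a transfer of sample [k]. Sign condition:
    weights in a transfer are nonnegative. *)
Lemma sample_product k l (f : T -> R) : k != l -> bmeas f -> (forall t, 0 <= f t) ->
  \int[Pr]_w (f (v k w) * f (v l w)) = \int[Pr]_w (\int[pi w]_t f t) ^+ 2.
Proof.
move=> kl bf f0; have [mf _] := bf.
have bpi := bmeas_kernel mpi pi1 bf.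
transitivity (\int[Pr]_w (f (v k w) * \int[\d_(v l w)]_t f t)).
  by apply: eq_Rintegral => w _; rewrite Rintegral_dirac.
apply: (@Rintegral_transfer _ _ _ _ _ _ _ Pr Pr (f \o v k) _
  (fun w => \d_(v l w)) pi) => //.
- exact: bmeas_comp.
- by move=> w; exact: f0.
- by move=> w; exact: Rintegral_ge0.
- by move=> B mB; exact: mdirac.
- by move=> w; rewrite /= diracT.
move=> C mC.
transitivity (\int[Pr]_w (\1_C (v l w) * \int[\d_(v k w)]_t f t)).
  by apply: eq_Rintegral => w _; rewrite Rintegral_dirac// mulrC.
under [RHS]eq_Rintegral do rewrite mulrC.
(* Now the weights are the indicator of [C] at sample [l] and the mass [pi w C], and [law2] is the
   required identity on sets. *)
apply: (@Rintegral_transfer _ _ _ _ _ _ _ Pr Pr (fun w => \1_C (v l w)) _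
  (fun w => \d_(v k w)) pi) => //.
- exact: bmeas_comp (mv l) (bmeas_indic R mC).
- exact: (bmeas_kernel_fine mpi pi1).
- by move=> B mB; exact: mdirac.
- by move=> w; rewrite /= diracT.
by move=> B mB; rewrite -(law2 kl).
Qed.

(** In the square of the sum, off-diagonal products contribute exactly the second moment of the
    random mean, and each of the [N.+1] diagonal ones exceeds it by at most 1. Division by the
    square of [N.+1] leaves an excess of at most [N.+1%:R^-1]. *)
Lemma sampling_error (f : T -> R) (a : R) : bmeas f -> (forall t, `|f t| <= 1) ->
  \int[Pr]_w (N.+1%:R^-1 * (\sum_(k < N.+1) f (v k w)) - a) ^+ 2 <=
  N.+1%:R^-1 + \int[Pr]_w (\int[pi w]_t f t - a) ^+ 2.
Proof.
move=> bf f1.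
(* Shifting f by 1 makes it nonnegative, as sample_product requires, and leaves
   the differences S f - a and pi f - a unchanged. *)
pose F t := f t + 1; pose b := a + 1.
have bF : bmeas F by apply: bmeasD => //; exact: bmeas_cst.
have bFv k : bmeas (fun w => F (v k w)) by exact: bmeas_comp (mv k) bF.
have F0 t : 0 <= F t by rewrite /F -lerBlDr sub0r; have := f1 t; rewrite ler_norml => /andP[].
have F2 t : F t <= 2 by rewrite /F -lerBrDr addrK; have := f1 t; rewrite ler_norml => /andP[].
have bpi := bmeas_kernel mpi pi1 bF.
pose p w := \int[pi w]_t F t.
pose Ep := \int[Pr]_w p w; pose Ep2 := \int[Pr]_w (p w) ^+ 2.
pose S w := \sum_(k < N.+1) F (v k w).
have bS : bmeas S by exact: bmeas_sum.
have ES : \int[Pr]_w S w = N.+1%:R * Ep.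
  rewrite bmeas_Rintegral_sum//; under eq_bigr do rewrite sample_mean//.
  by rewrite sumr_const card_ord -[LHS]mulr_natl.
(* For values in [0, 2] the variance is at most 1: [F ^+ 2 <= 2 * F], and twice the mean is at most
   its square plus 1. *)
have diag k : \int[Pr]_w (F (v k w)) ^+ 2 <= Ep2 + 1.
  apply: (@le_trans _ _ (\int[Pr]_w (2 * F (v k w)))).
    apply: bmeas_le_Rintegral => //; [exact: bmeasX|exact: bmeasZ|].
    by move=> w; rewrite expr2 ler_wpM2r.
  rewrite bmeas_RintegralZ// sample_mean// -bmeas_RintegralZ//.
  rewrite -(mass1_RintegralDr (@probability_setT _ _ _ Pr))//; last exact: bmeasX.
  apply: bmeas_le_Rintegral => //; first exact: bmeasZ.
    by apply: bmeasD; [exact: bmeasX|exact: bmeas_cst].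
  by move=> w; rewrite -subr_ge0; have := sqr_ge0 (\int[pi w]_t F t - 1);
    rewrite sqrrB expr1n mulr1 mulr_natl addrAC.
have ES2 : \int[Pr]_w (S w) ^+ 2 <= N.+1%:R ^+ 2 * Ep2 + N.+1%:R.
  rewrite (_ : (fun w => S w ^+ 2) =
      fun w => \sum_(k < N.+1) \sum_(l < N.+1) F (v k w) * F (v l w)); last first.
    by apply/funext => w; rewrite expr2 /S big_distrlr.
  rewrite bmeas_Rintegral_sum//; last first.
    by move=> k; apply: bmeas_sum => l; exact: bmeasM.
  apply: (@le_trans _ _ (\sum_(k < N.+1) (N.+1%:R * Ep2 + 1))); last first.
    by rewrite sumr_const card_ord -[leLHS]mulr_natl mulrDr mulr1 mulrA expr2.
  apply: ler_sum => k _; rewrite bmeas_Rintegral_sum//; last first.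
    by move=> l; exact: bmeasM.
  (* Row [k] has one diagonal entry and [N] others, each equal to [Ep2]. *)
  rewrite (bigD1 k)//=; under eq_bigr => l lk do rewrite sample_product// 1?eq_sym//.
  rewrite sumr_const cardC1 card_ord/= mulrSr -mulr_natl [N%:R + 1]addrC mulrDl mul1r.
  rewrite addrAC lerD2r; exact: diag.
have N0 : N.+1%:R != 0 :> R by rewrite pnatr_eq0.
(* Used for the sample mean and for [p]: by [ES] their first moments agree, so only the second
   moments remain to be compared. *)
have expand Z : bmeas Z -> \int[Pr]_w (Z w - b) ^+ 2 =
    \int[Pr]_w (Z w) ^+ 2 - 2 * b * \int[Pr]_w Z w + b ^+ 2.
  move=> bZ; rewrite -bmeas_RintegralZ// -bmeas_RintegralB//; [|exact: bmeasX|exact: bmeasZ].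
  rewrite -(mass1_RintegralDr (@probability_setT _ _ _ Pr)); last first.
    by apply: bmeasB; [exact: bmeasX|exact: bmeasZ].
  by apply: eq_Rintegral => w _; ring.
have -> : (fun w => (\int[pi w]_t f t - a) ^+ 2) = (fun w => (p w - b) ^+ 2).
  apply/funext => w; rewrite /p /F /b (mass1_RintegralDr (pi1 w))//; congr (_ ^+ 2).
  by rewrite opprD addrACA subrr addr0.
have -> : (fun w => (N.+1%:R^-1 * (\sum_(k < N.+1) f (v k w)) - a) ^+ 2) =
    (fun w => (N.+1%:R^-1 * S w - b) ^+ 2).
  apply/funext => w; rewrite /S /F /b big_split/= sumr_const card_ord; congr (_ ^+ 2).
  by rewrite mulrDr mulVf// opprD addrACA subrr addr0.
rewrite !expand//; last exact: bmeasZ.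
under [X in X - _ + _ <= _]eq_Rintegral do rewrite exprMn.
rewrite !bmeas_RintegralZ//; last exact: bmeasX.
rewrite ES mulKf// !addrA !lerD2r.
rewrite exprVn ler_pdivrMl ?exprn_gt0 ?ltr0Sn//.
by rewrite (le_trans ES2)// mulrDr [leRHS]addrC lerD2l expr2 mulfK.
Qed.

End sampling.

(** * Stability of the likelihood update *)

Lemma ratio_error (R : realFieldType) (kappa a b a' b' : R) :
  0 < kappa -> kappa <= b -> 0 < b' -> `|a'| <= b' ->
  `|a / b - a' / b'| <= kappa^-1 * (`|a - a'| + `|b - b'|).
Proof.
move=> k0 kb b'0 a'b'; have b0 : 0 < b by exact: lt_le_trans kb.
(* The quotient [a' / b'] has modulus at most 1, so the only amplification is by [b^-1], at most
   [kappa^-1]. *)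
have -> : a / b - a' / b' = b^-1 * ((a - a') - a' / b' * (b - b')).
  by field; rewrite !gt_eqF.
rewrite normrM; apply: ler_pM => //.
  by rewrite ger0_norm ?invr_ge0 ?(ltW b0)// lef_pV2.
rewrite (le_trans (ler_normB _ _))// lerD2l normrM ler_piMl//.
by rewrite normrM normfV (gtr0_norm b'0) ler_pdivrMr// mul1r.
Qed.

Section analysis_stability.
Context (R : realType) (n m : nat).
Variables (h : continuousType 'cV[R]_n 'cV[R]_m) (Gamma : 'M[R]_m).
Variables (c : {posnum R}) (y : 'cV[R]_m) (kappa : R).
Local Notation g := (likelihood h Gamma c y).
Hypothesis kappa_gt0 : 0 < kappa.
Hypothesis g_bound : forall u, kappa <= g u <= kappa^-1.

Lemma scaled_likelihood_le1 u : `|kappa * g u| <= 1.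
Proof.
rewrite ger0_norm; last by rewrite mulr_ge0// ltW// likelihood_gt0.
by rewrite -ler_pdivlMl// mulr1; case/andP: (g_bound u).
Qed.

(** The factor [kappa] makes both integrands test functions bounded by 1. Undoing it costs
    [kappa ^- 2], squaring [ratio_error] costs another [kappa ^- 2], and the 2 comes from
    [(s + t) ^+ 2 <= 2 * (s ^+ 2 + t ^+ 2)]. *)
Lemma analysis_error (mu nu : {measure set 'cV[R]_n -> \bar R})
    (f : 'cV[R]_n -> R) :
  mu setT = 1%E -> nu setT = 1%E -> bmeas f -> (forall u, `|f u| <= 1) ->
  (\int[analysis h Gamma c y mu]_u f u - \int[analysis h Gamma c y nu]_u f u) ^+ 2 <=
  2 * kappa ^- 4 *
    ((\int[mu]_u (kappa * g u * f u) - \int[nu]_u (kappa * g u * f u)) ^+ 2 +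
     (\int[mu]_u (kappa * g u) - \int[nu]_u (kappa * g u)) ^+ 2).
Proof.
move=> mu1 nu1 bf f1.
have bg := bmeas_likelihood g_bound; have bgf := bmeasM bg bf.
have muoo : (mu setT < +oo)%E by rewrite mu1 ltry.
have nuoo : (nu setT < +oo)%E by rewrite nu1 ltry.
rewrite !(Rintegral_analysis kappa_gt0 g_bound)//.
under [X in (X - _) ^+ 2 + _]eq_Rintegral do rewrite -mulrA.
under [X in (_ - X) ^+ 2 + _]eq_Rintegral do rewrite -mulrA.
rewrite !(bmeas_RintegralZ muoo kappa)// !(bmeas_RintegralZ nuoo kappa)// -!mulrBr.
set a := \int[mu]_u (g u * f u); set b := \int[mu]_u g u.
set a' := \int[nu]_u (g u * f u); set b' := \int[nu]_u g u.
have kb : kappa <= b by exact: Rintegral_likelihood_ge.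
have kb' : kappa <= b' by exact: Rintegral_likelihood_ge.
have a'b' : `|a'| <= b'.
  have gf u : `|g u * f u| <= g u.
    have g0 : 0 <= g u by rewrite ltW// likelihood_gt0.
    by rewrite normrM (ger0_norm g0) ler_piMr.
  rewrite (le_trans (le_normr_Rintegral _ _))//; first exact: bmeas_integrable.
  apply: bmeas_le_Rintegral => //.
  split; last by have [_ [M gM]] := bgf; exists M => u; rewrite normr_id.
  by apply: measurableT_comp => //; case: bgf.
have := ratio_error a kappa_gt0 kb (lt_le_trans kappa_gt0 kb') a'b'.
set e := a / b - a' / b' => err.
have {err} : e ^+ 2 <= (kappa^-1 * (`|a - a'| + `|b - b'|)) ^+ 2.
  by rewrite -[e ^+ 2]real_normK ?num_real// lerXn2r// nnegrE (le_trans _ err).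
move=> /le_trans; apply.
rewrite -(real_normK (num_real (kappa * (a - a')))) -(real_normK (num_real (kappa * (b - b')))).
rewrite !normrM (gtr0_norm kappa_gt0).
set s := `|a - a'|; set t := `|b - b'|.
have -> : 2 * kappa ^- 4 * ((kappa * s) ^+ 2 + (kappa * t) ^+ 2) =
    (kappa^-1) ^+ 2 * (2 * (s ^+ 2 + t ^+ 2)).
  by field; rewrite gt_eqF.
rewrite exprMn ler_wpM2l ?sqr_ge0// -subr_ge0.
by rewrite (_ : _ - _ = (s - t) ^+ 2) ?sqr_ge0//; ring.
Qed.

End analysis_stability.

(** * Propagation of the error along the filter *)

Section particle_filter_error.
Context (R : realType) (n m : nat).
Variables (Psi : continuousType 'cV[R]_n 'cV[R]_n).
Variables (h : continuousType 'cV[R]_n 'cV[R]_m).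
Variables (m0 : 'cV[R]_n) (C0 Sigma : 'M[R]_n) (Gamma : 'M[R]_m).
Variables (c : nat -> {posnum R}) (y : nat -> 'cV[R]_m).
Variables (N : nat) (d : measure_display) (Omega : measurableType d).
Variable Pr : probability Omega R.
Variable v : nat -> 'I_N.+1 -> Omega -> 'cV[R]_n.
Hypothesis fresh_v : fresh_samples Psi h m0 C0 Sigma Gamma c y Pr v.
Variable kappa : R.
Hypothesis kappa_gt0 : 0 < kappa.
Hypothesis g_bound : forall (u : 'cV[R]_n) (j : nat),
  kappa <= likelihood h Gamma (c j) (y j.+1) u <= kappa^-1.

Local Notation p := (transition Psi Sigma).
Local Notation pf := (particle_filter h m0 C0 Gamma c y v).
Local Notation mu := (filtering Psi h m0 C0 Sigma Gamma c y).
Local Notation g j := (likelihood h Gamma (c j) (y j.+1)).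

Let Pr_fin : (Pr setT < +oo)%E. Proof. by rewrite probability_setT ltry. Qed.

Let bg j : bmeas (g j). Proof. by apply: bmeas_likelihood => u; exact: g_bound. Qed.

Let mv j k : measurable_fun setT (v j k). Proof. by case: fresh_v. Qed.

Let emp1 j w : empirical (v j ^~ w) setT = 1%E :> \bar R.
Proof. exact: empirical_setT. Qed.

Lemma bmeas_Rintegral_empirical j (f : 'cV[R]_n -> R) : bmeas f ->
  bmeas (fun w => \int[empirical (v j ^~ w)]_u f u).
Proof.
move=> bf; under eq_fun do rewrite Rintegral_empirical//.
apply: bmeasZ; apply: bmeas_sum => k; exact: bmeas_comp (mv j k) bf.
Qed.

(** The mass of [B] is a quotient of two integrals against the empirical measure, each measurable in
    the samples. The particle filter is thereby a kernel on [Omega]. *)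
Lemma measurable_particle_filter j B : measurable B ->
  measurable_fun setT (fun w => pf j w B).
Proof.
case: j => [|j] mB; first exact: measurable_cst.
have -> : (fun w => pf j.+1 w B) = (fun w =>
    ((\int[empirical (v j ^~ w)]_u (g j u * \1_B u)) /
     \int[empirical (v j ^~ w)]_u g j u)%:E).
  apply/funext => w.
  rewrite -(Rintegral_analysis kappa_gt0 (g_bound ^~ j) (emp1 j w) (bmeas_indic R mB)).
  rewrite /Rintegral integral_indic// setIT fineK//.
  exact: fin_num_measure.
apply/measurable_EFinP; apply: measurable_funM.
  by have [] := bmeas_Rintegral_empirical j (bmeasM (bg j) (bmeas_indic R mB)).
have [mE _] := bmeas_Rintegral_empirical j (bg j).
(* Inversion is continuous on the open set of nonzero reals, where the denominators, at least
   [kappa], all lie. *)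
apply: (@measurable_comp _ _ _ _ _ _ [set r : R | r != 0]) => //.
- exact: open_measurable.
- move=> _ [w _ <-] /=; rewrite gt_eqF// (lt_le_trans kappa_gt0)//.
  by apply: Rintegral_likelihood_ge => [u|]; [exact: g_bound|exact: emp1].
- apply: open_continuous_measurable_fun => //; apply/in_setP => r /= r0.
  exact: inv_continuous.
Qed.

Let pf1 j w : pf j w setT = 1%E. Proof. exact: probability_setT. Qed.

Let bpf j (f : 'cV[R]_n -> R) : bmeas f -> bmeas (fun w => \int[pf j w]_u f u).
Proof.
move=> bf; apply: (bmeas_kernel (k := fun w => pf j w)) bf => [B|w].
  exact: measurable_particle_filter.
exact: pf1.
Qed.

(** [sampling_error] is applied with the random measure [q w], the prediction from the particle
    filter, and with [a] the integral of [f] against the exact prediction. *)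
Let prediction_error j (f : 'cV[R]_n -> R) (e : R) : bmeas f ->
  (forall u, `|f u| <= 1) ->
  (forall f : 'cV[R]_n -> R, bmeas f -> (forall u, `|f u| <= 1) ->
    \int[Pr]_w (\int[pf j w]_u f u - \int[mu j]_u f u) ^+ 2 <= e) ->
  \int[Pr]_w (\int[empirical (v j ^~ w)]_u f u - \int[predict p (mu j)]_u f u) ^+ 2
  <= N.+1%:R^-1 + e.
Proof.
move=> bf f1 He; under eq_Rintegral do rewrite Rintegral_empirical//.
have mp B : measurable B -> measurable_fun setT (p ^~ B) by exact: measurable_kernel.
have p1 u : p u setT = 1%E by exact: prob_kernel.
pose q w : {measure set 'cV[R]_n -> \bar R} := predict p (pf j w).
have mq B : measurable B -> measurable_fun setT (q ^~ B).
  move=> mB; rewrite /q /= /predict.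
  apply: (measurable_fun_integral_kernel (l := fun w => pf j w)) => //.
    by move=> U mU; exact: measurable_particle_filter.
  exact: mp.
have q1 w : q w setT = 1%E by exact: probability_setT.
apply: (le_trans (@sampling_error _ _ _ _ _ Pr N (v j) q (mv j) mq q1 _ f _ bf f1)).
  (* With the whole space as past event, fresh sampling gives the joint law that [iid] asks for. *)
  move=> B mB; have [_ /(_ j setT B)] := fresh_v.
  rewrite setTI; apply => //.
  exact: (@measurableT _ (g_sigma_algebraType _)).
(* The transition moves onto the test function: integrating [f] against [p u] gives another function
   bounded by 1. *)
rewrite lerD2l; under eq_Rintegral do rewrite !Rintegral_predict//.
apply: He; first exact: (bmeas_kernel mp p1 bf).
by move=> u; exact: (mass1_normr_Rintegral (p1 u) bf f1).
Qed.

(** The induction is over all test functions at once, because each step replaces [f] by others built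
    from the likelihood and the transition. *)
Lemma particle_filter_error j (f : 'cV[R]_n -> R) : bmeas f ->
  (forall u, `|f u| <= 1) ->
  \int[Pr]_w (\int[pf j w]_u f u - \int[mu j]_u f u) ^+ 2 <=
  (\sum_(1 <= i < j.+1) (2 * kappa ^- 2) ^+ i * (Num.sqrt N.+1%:R)^-1) ^+ 2.
Proof.
elim: j f => [|j ih] f bf f1.
  (* At time 0 both filters are the same Gaussian, so the error vanishes. *)
  under eq_Rintegral do rewrite subrr expr0n/=.
  by rewrite Rintegral_cst// mul0r sqr_ge0.
set r := 2 * kappa ^- 2; set t := (Num.sqrt N.+1%:R)^-1 : R.
pose s := \sum_(1 <= i < j.+1) r ^+ i * t; pose e := s ^+ 2.
have {}ih : forall f : 'cV[R]_n -> R, bmeas f -> (forall u, `|f u| <= 1) ->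
  \int[Pr]_w (\int[pf j w]_u f u - \int[mu j]_u f u) ^+ 2 <= e by [].
have bphi1 : bmeas (fun u => kappa * g j u) by exact: bmeasZ.
have bphi2 : bmeas (fun u => kappa * g j u * f u) by exact: bmeasM.
have phi1 u : `|kappa * g j u| <= 1 by exact: scaled_likelihood_le1.
have phi2 u : `|kappa * g j u * f u| <= 1.
  by rewrite normrM mulr_ile1.
have err1 := prediction_error bphi1 phi1 ih.
have err2 := prediction_error bphi2 phi2 ih.
have bsq (phi : 'cV[R]_n -> R) (a : R) : bmeas phi ->
    bmeas (fun w => (\int[empirical (v j ^~ w)]_u phi u - a) ^+ 2).
  move=> bphi; apply: bmeasX.
  exact: (bmeasB (bmeas_Rintegral_empirical j bphi) (bmeas_cst _ a)).
(* The pointwise bound [analysis_error] is integrated over [Pr], and each of its two terms is a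
   prediction error. *)
apply: (@le_trans _ _ (2 * kappa ^- 4 * ((N.+1%:R^-1 + e) + (N.+1%:R^-1 + e)))).
  apply: le_trans (ler_wpM2l _ (lerD err2 err1)); last first.
    by rewrite mulr_ge0// invr_ge0 exprn_ge0// ltW.
  rewrite -bmeas_RintegralD; [|exact: Pr_fin|exact: bsq|exact: bsq].
  rewrite -bmeas_RintegralZ; [|exact: Pr_fin|by apply: bmeasD; exact: bsq].
  apply: bmeas_le_Rintegral => //.
  - by apply: bmeasX; apply: bmeasB (@bpf j.+1 _ bf) (bmeas_cst _ _).
  - by apply: bmeasZ; apply: bmeasD; exact: bsq.
  - move=> w; apply: analysis_error bf f1 => //.
    + exact: emp1.
    + exact: probability_setT.
have r0 : 0 <= r by rewrite mulr_ge0// invr_ge0 exprn_ge0// ltW.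
have t0 : 0 <= t by rewrite invr_ge0 sqrtr_ge0.
have s0 : 0 <= s by apply: sumr_ge0 => i _; rewrite mulr_ge0// exprn_ge0.
have -> : N.+1%:R^-1 = t ^+ 2 :> R by rewrite /t exprVn sqr_sqrtr.
(* Splitting off the term of index 1 and shifting the rest exhibits the recursion of the bound. *)
have -> : \sum_(1 <= i < j.+2) r ^+ i * t = r * t + r * s.
  rewrite big_ltn// expr1; congr (_ + _).
  rewrite big_add1/= mulr_sumr; apply: eq_bigr => i _.
  by rewrite exprS mulrA.
have -> : 2 * kappa ^- 4 * (t ^+ 2 + e + (t ^+ 2 + e)) = r ^+ 2 * (t ^+ 2 + s ^+ 2).
  by rewrite /r /e; field; rewrite gt_eqF.
rewrite -mulrDr [leRHS]exprMn ler_wpM2l ?sqr_ge0// -subr_ge0.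
(* What remains is [t ^+ 2 + s ^+ 2 <= (t + s) ^+ 2] for nonnegative [t] and [s]. *)
rewrite (_ : _ - _ = 2 * (t * s)); last by ring.
by rewrite !mulr_ge0.
Qed.

End particle_filter_error.

(** * Passage to the distance between random measures *)

Theorem theorem4p5 (R : realType) (n m : nat)
    (Psi : continuousType 'cV[R]_n 'cV[R]_n)
    (h : continuousType 'cV[R]_n 'cV[R]_m)
    (m0 : 'cV[R]_n) (C0 Sigma : 'M[R]_n) (Gamma : 'M[R]_m)
    (posC0 : posdef C0) (posSigma : posdef Sigma) (posGamma : posdef Gamma)
    (c : nat -> {posnum R}) (y : nat -> 'cV[R]_m)
    (N : nat) (N_ge1 : (1 <= N)%N)
    (d : measure_display) (Omega : measurableType d) (Pr : probability Omega R)
    (v : nat -> 'I_N -> Omega -> 'cV[R]_n)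
    (fresh_v : fresh_samples Psi h m0 C0 Sigma Gamma c y Pr v)
    (kappa : R) (kappa_gt0 : 0 < kappa) (kappa_le1 : kappa <= 1)
    (kappa_bound : forall (u : 'cV[R]_n) (j : nat),
      kappa <= likelihood h Gamma (c j) (y j.+1) u <= kappa^-1)
    (J : nat) (J_ge1 : (1 <= J)%N) :
  (rpm_dist Pr
     (particle_filter h m0 C0 Gamma c y v J)
     (fun=> filtering Psi h m0 C0 Sigma Gamma c y J)
   <= (\sum_(1 <= j < J.+1)
         (2 * kappa ^- 2) ^+ j * (Num.sqrt N%:R)^-1)%:E)%E.
Proof.
case: N N_ge1 v fresh_v => [//|{}N] _ {}v fresh_v.
apply: ge_ereal_sup => _ [f [mf f1] <-].
have bf : bmeas f by split => //; exists 1.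
set s := \sum_(1 <= j < J.+1) _.
have s0 : 0 <= s.
  apply: sumr_ge0 => j _; rewrite mulr_ge0 ?invr_ge0 ?sqrtr_ge0// exprn_ge0//.
  by rewrite mulr_ge0// invr_ge0 exprn_ge0// ltW.
have bpf : bmeas (fun w => \int[particle_filter h m0 C0 Gamma c y v J w]_u f u).
  apply: (bmeas_kernel (k := fun w => particle_filter h m0 C0 Gamma c y v J w)) bf => [B|w].
    exact: (measurable_particle_filter fresh_v kappa_gt0 kappa_bound).
  exact: probability_setT.
have Pr_fin : (Pr setT < +oo)%E by rewrite probability_setT ltry.
rewrite expectation.unlock.
under eq_integral do rewrite real_normK ?num_real//.
(* The squared error is bounded and measurable in [w], so its expectation is a real number and
   [sqrte] becomes a real square root. *)
rewrite (bmeas_fineK Pr_fin) /=; last first.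
  by apply: bmeasX; exact: bmeasB bpf (bmeas_cst _ _).
(* Writing the nonnegative [s] as the root of its square reduces the claim to the bound on the
   squared error. *)
rewrite lee_fin -[leRHS]ger0_norm// -sqrtr_sqr ler_wsqrtr//.
exact: (particle_filter_error fresh_v kappa_gt0 kappa_bound).
Qed.
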